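(* There is a function $f:[\omega_1]^2 \to \omega_1$ such that whenever $A,B \subseteq \omega_1$ are uncountable and $\xi < \omega_1$, there are $\alpha \in A$ and $\beta \in B$ such that $\alpha < \beta$ and $f(\alpha,\beta) = \xi$. In particular, $\omega_1 \not\rightarrow (\omega_1;\omega_1)^2_2$.
   Context: The ambient theory is ZFC, with no additional axioms. $[\omega_1]^2$ is the set of two-element subsets of $\omega_1$; for $\alpha<\beta$ one writes $f(\alpha,\beta)$ for $f(\{\alpha,\beta\})$. The relation $\omega_1 \rightarrow (\omega_1;\omega_1)^2_2$ asserts that for every $c:[\omega_1]^2\to 2$ there are uncountable $A,B\subseteq\omega_1$ such that $c$ is constant on the set of pairs $\{\alpha,\beta\}$ with $\alpha\in A$, $\beta\in B$, $\alpha<\beta$; $\omega_1 \not\rightarrow (\omega_1;\omega_1)^2_2$ is its negation. *)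

(* Defs.v *)
From HB Require Import structures.
From mathcomp Require Import all_boot all_order.
From mathcomp Require Import boolp classical_sets functions cardinality wochoice.

Set Implicit Arguments.
Unset Strict Implicit.
Unset Printing Implicit Defensive.

Import Order.TTheory.

Local Open Scope classical_set_scope.
Local Open Scope order_scope.

(* The least uncountable ordinal, up to order isomorphism: an uncountable
   well-order all of whose proper initial segments are countable.  Such orders
   exist ([omega1_exists] below) and any two of them are isomorphic. *)
Definition is_omega1 (d : Order.disp_t) (W : orderType d) : Prop :=
  [/\ well_order (<=%O : rel W),
      ~ countable [set: W] &
      forall x : W, countable [set y : W | y < x]].

Definition uncountable (T : Type) (A : set T) : Prop := ~ countable A.

(* [T]^2 *)
Definition pairs (T : Type) : Type :=
  {s : set T | exists x y : T, x <> y /\ s = [set x; y]}.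

Lemma upair_subproof (d : Order.disp_t) (W : orderType d) (a b : W) :
  a < b -> exists x y : W, x <> y /\ [set a; b] = [set x; y].
Proof. by move=> ab; exists a, b; split=> // e; rewrite e ltxx in ab. Qed.

(* The unordered pair {a, b}, for a < b. *)
Definition upair (d : Order.disp_t) (W : orderType d) (a b : W) (ab : a < b) :
    pairs W :=
  exist _ [set a; b] (upair_subproof ab).

(* W --> (W; W)^2_2, with "large" meaning uncountable; colours are booleans. *)
Definition polarized_arrow (d : Order.disp_t) (W : orderType d) : Prop :=
  forall c : pairs W -> bool,
  exists A B : set W,
    [/\ uncountable A, uncountable B &
        exists i : bool, forall (a b : W) (ab : a < b),
          A a -> B b -> c (upair ab) = i].

Lemma uncountable_cantor : uncountable [set: nat -> bool].
Proof.
move=> /countable_injP[f /in2TT f_inj].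
pose D n : bool := `[< ~ exists h : nat -> bool, f h = n /\ h n >].
have nD : ~ D (f D) by move=> DD; have /asboolP := DD; apply; exists D.
by apply: (nD); apply/asboolP => -[h [/f_inj ->]].
Qed.

Lemma well_order_anti (T : eqType) (R : rel T) : well_order R -> antisymmetric R.
Proof.
by move=> woR x y; apply: (@wo_chain_antisymmetric T R predT) => // A _; exact: woR.
Qed.

Lemma well_order_sub (T : choiceType) (R : rel T) (P : pred T) :
  well_order R ->
  exists (d : Order.disp_t) (W : orderType d) (v : W -> T),
    [/\ injective v, range v = [set x | P x],
        forall x y : W, (x <= y) = R (v x) (v y) &
        well_order (<=%O : rel W)].
Proof.
move=> woR.
have Rtot : total R.
  by move=> x y; apply: (@wo_chainW T R predT) => // A _; exact: woR.
have Ranti : antisymmetric R by exact: well_order_anti.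
have Rxx x : R x x by have := Rtot x x; rewrite orbb.
have Rtr : transitive R.
  move=> y x z xy yz.
  have [|m [[mA mmin] _]] := woR [pred t | t \in [:: x; y; z]].
    by exists x; rewrite !inE eqxx.
  have xA : x \in [pred t | t \in [:: x; y; z]] by rewrite !inE eqxx.
  have yA : y \in [pred t | t \in [:: x; y; z]] by rewrite !inE eqxx !orbT.
  have zA : z \in [pred t | t \in [:: x; y; z]] by rewrite !inE eqxx !orbT.
  have := mA; rewrite !inE => /or3P[] /eqP e; subst m.
  - exact: mmin.
  - by have -> : x = y by apply: Ranti; rewrite xy mmin.
  - have e : y = z by apply: Ranti; rewrite yz mmin.
    by rewrite -e.
pose S := {x : T | P x}.
pose le (x y : S) := R (val x) (val y).
have le_anti : antisymmetric le by move=> x y /Ranti /val_inj.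
have le_trans : transitive le by move=> y x z; exact: Rtr.
have le_total : total le by move=> x y; exact: Rtot.
pose disp := Order.Disp tt tt.
pose mx := Order.isOrder.Build disp S
  (fun=> fun=> erefl) (fun=> fun=> erefl) (fun=> fun=> erefl)
  le_anti le_trans le_total.
pose W : orderType disp := HB.pack S mx.
exists disp, W, (fun w : S => val w); split=> //.
- apply/seteqP; split=> [_ [x _ <-]|x Px] /=; first exact: (valP x).
  by exists (exist _ x Px).
- move=> A [a aA].
  have [|m [[/asboolP[m' [mA em]] mmin] _]] :=
    woR [pred t | `[< exists w : W, w \in A /\ val w = t >]].
    by exists (val a); apply/asboolP; exists a.
  subst m; exists m'; split.
    by split=> // x xA; apply: mmin; apply/asboolP; exists x.
  move=> x [xA xmin]; apply: (le_anti); apply/andP; split.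
    by apply: mmin; apply/asboolP; exists x.
  exact: xmin.
Qed.

Lemma omega1_exists :
  exists (d : Order.disp_t) (W : orderType d), is_omega1 W.
Proof.
have [R woR] := well_ordering_principle (nat -> bool).
have Ranti : antisymmetric R by exact: well_order_anti.
pose I x := [set y | (y != x) && R y x].
have [Ic|/existsNP[x0 x0P]] := pselect (forall x, countable (I x)).
  have [d [W [v [vi vr vle woW]]]] := well_order_sub predT woR.
  exists d, W; split=> //.
    move=> Wc; apply: uncountable_cantor.
    have -> : [set: nat -> bool] = range v by rewrite vr; apply/seteqP; split.
    exact: sub_countable (card_image_le _ _) Wc.
  move=> x; apply: sub_countable (Ic (v x)).
  rewrite -(card_le_eql (inj_card_eq (in2W vi))).
  apply: subset_card_le => _ [y /= yx <-].
  by rewrite /I /= -vle (ltW yx) (inj_eq vi) (lt_eqF yx).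
have [|m [[/asboolP mP mmin] _]] := woR [pred x | `[< ~ countable (I x) >]].
  by exists x0; apply/asboolP.
have [d [W [v [vi vr vle woW]]]] :=
  well_order_sub [pred y | (y != m) && R y m] woR.
exists d, W; split=> //.
  move=> Wc; apply: mP; have -> : I m = range v by rewrite vr.
  exact: sub_countable (card_image_le _ _) Wc.
move=> x; apply: (@sub_countable _ _ _ (I (v x))).
  rewrite -(card_le_eql (inj_card_eq (in2W vi))).
  apply: subset_card_le => _ [y /= yx <-].
  by rewrite /I /= -vle (ltW yx) (inj_eq vi) (lt_eqF yx).
have : range v (v x) by exists x.
rewrite vr /= => /andP[/eqP vxm vxRm]; apply: contrapT => nc.
by apply: vxm; apply: Ranti; rewrite vxRm mmin//; apply/asboolP.
Qed.

(* Main.v *)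
Require Import Defs.
From mathcomp Require Import all_boot all_order.
From mathcomp Require Import zify.
From mathcomp Require Import boolp classical_sets functions cardinality.

Set Implicit Arguments.
Unset Strict Implicit.
Unset Printing Implicit Defensive.

Import Order.TTheory.

Local Open Scope classical_set_scope.
Local Open Scope order_scope.

(** The proof follows the oscillation method that Moore introduced for the
    L space problem.

    Enumerate every proper initial segment of omega_1 as a sequence [e b] and
    walk from [b] down to [a] by repeatedly passing from [c] to the first
    [e c i] that is at least [a].  Two objects are read off the walk.  The
    maximum of the indices used, [weight b a], gives functions [weight b] on
    the predecessors of [b] that are finite-to-one ([weight_finite_to_one])
    and that for different [b] differ in finitely many places only
    ([weight_coherent]).  The running maxima of the elements passed over below
    [a] give a finite subset of the predecessors of [a], the lower trace
    [lower a b]; it concatenates, [lower a b] being [lower dl b] followed by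
    [lower a dl], once [a < dl <= b] is close enough to [dl] ([lower_cat]).
    The oscillation [osc a b] counts how often, along [lower a b], the
    comparison of [weight a] with [weight b] switches from
    [weight a <= weight b] to [weight a > weight b].

    The heart is [oscillation]: if [A] and [B] are unbounded then for every [N]
    there are a single [a] in [A] and [b 0], ..., [b N] in [B] above [a] with
    [osc a (b m) = c + m].  To see this, fix a point [dl] closed under suitable
    functions (this replaces a countable elementary submodel) and work with
    [a] and [b] above [dl].  By coherence and pigeonhole, the situation of [dl],
    [a], [b] recurs at arbitrarily large [dl1] with [a1], [b1] above it, and
    [lower dl b1] is [lower dl b] followed by the new block [lower dl dl1].  On
    the block [weight a1] and [weight b1] both coincide with [weight dl1], so
    the comparison there is an equality; and since the weights are
    finite-to-one, [a1] can alternatively be replaced by some [a2] in [A] whose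
    weight exceeds that of [b1] on the whole block ([oscillation_step]).
    Alternating the two kinds of extension adds one switch at a time.  In the
    end [a] is reflected to a point of [A] below [dl].

    For each [i], every long enough interval of integers contains an element of
    2-adic valuation [i], so the valuation of [osc a b + 1] takes every natural number as
    a value on [A] and [B].  Using this number as an index into the enumeration
    [e b] of the predecessors of [b] turns countably many colours into omega_1
    many: the index of [xi] in [e b] is the same for unboundedly many [b] in
    [B].  Two of the colours suffice to refute the polarized arrow. *)

(** * Countable subsets and closure points of omega_1 *)

Definition unbounded (d : Order.disp_t) (W : orderType d) (A : set W) : Prop :=
  forall g, exists2 a, A a & g < a.

Section Omega1.
Context {d : Order.disp_t} {W : orderType d} (W1 : is_omega1 W).
Implicit Types (a b g x y : W) (A B P : set W).

Lemma omega1_least P : P !=set0 -> exists2 x, P x & forall y, P y -> x <= y.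
Proof.
case=> p Pp; have [wo _ _] := W1.
have [|m [[/asboolP Pm mmin] _]] := wo [pred x | `[< P x >]].
  by exists p; apply/asboolP.
by exists m => // y Py; apply: mmin; apply/asboolP.
Qed.

Lemma omega1_wf : well_founded (fun x y : W => is_true (x < y)).
Proof.
move=> y; apply: contrapT => ny.
have [m nm mmin] := @omega1_least [set x | ~ Acc (fun x y : W => is_true (x < y)) x]
  (ex_intro _ y ny).
apply: nm; split=> z zm; apply: contrapT => /mmin.
by rewrite leNgt zm.
Qed.

(** A countable cofinal set would cover omega_1 by countably many countable
    initial segments.  The same argument shows that there is no last point,
    which gives the strict bound. *)
Lemma countable_bounded A : countable A -> exists g, forall a, A a -> a < g.
Proof.
have [_ ncW cI] := W1.
have noMax g : exists h, g < h.
  apply: contrapT => /forallNP nh; apply: ncW.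
  have -> : [set: W] =
      \bigcup_(i in [set: bool]) (if i then [set y | y < g] else [set g]).
    apply/seteqP; split=> // x _; have /negP := nh x.
    by rewrite -leNgt le_eqVlt => /orP[/eqP->|xg]; [exists false|exists true].
  by apply: bigcup_countable => // -[] _ //; exact: countable1.
move=> cA; apply: contrapT => /forallNP ng; apply: ncW.
have -> : [set: W] = \bigcup_(a in A) [set y | y < a].
  apply/seteqP; split=> // x _; have [h xh] := noMax x.
  have /existsNP[a /not_implyP[Aa /negP]] := ng h.
  by rewrite -leNgt => /(lt_le_trans xh) xa; exists a.
exact: bigcup_countable.
Qed.

Lemma uncountable_unbounded A : uncountable A -> unbounded A.
Proof.
move=> uA g; apply: contrapT => nA; have [_ _ cI] := W1.
have [h gh] := countable_bounded (countable1 g).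
apply: uA; apply: sub_countable (cI h); apply: subset_card_le => a Aa /=.
apply: le_lt_trans (gh g erefl); rewrite leNgt; apply/negP => ga.
by apply: nA; exists a.
Qed.

Lemma seq_bounded (T : countType) (u : T -> W) : exists g, forall t, u t < g.
Proof.
have [|g ug] := @countable_bounded (range u); last first.
  by exists g => t; apply: ug; exists t.
apply: sub_countable (card_image_le _ _) _; exact: countableP.
Qed.

Lemma unbounded_piece (B : set W) (T : countType) (F : T -> set W) :
  unbounded B -> (forall b, B b -> exists t, F t b) -> exists t, unbounded (B `&` F t).
Proof.
move=> uB cov; apply: contrapT => /forallNP nF.
have bF t : exists g, forall b, B b -> F t b -> b <= g.
  have /existsNP[g ng] := nF t; exists g => b Bb Fb.
  by rewrite leNgt; apply/negP => gb; apply: ng; exists b.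
have [u uP] := choice bF; have [g ug] := seq_bounded u.
have [b Bb gb] := uB g; have [t Ft] := cov b Bb.
by have := lt_trans (ug t) gb; rewrite ltNge (uP t b Bb Ft).
Qed.

(** The hypothesis [a < b] exempts the least point, which has no predecessors. *)
Definition enumerates (e : W -> nat -> W) : Prop :=
  forall b a, a < b -> (exists i, e b i = a) /\ forall i, e b i < b.

Lemma enumeration_exists : exists e, enumerates e.
Proof.
have [_ _ cI] := W1.
suff /choice[e eP] b : exists u : nat -> W,
    forall a, a < b -> (exists i, u i = a) /\ forall i, u i < b by exists e.
have [[a0 a0b]|nb] := pselect (exists a, a < b); last first.
  by exists (fun=> b) => a ab; exfalso; apply: nb; exists a.
have /countable_injP[f finj] := cI b.
exists (fun i => xget a0 [set a | a < b /\ f a = i]) => a ab; split.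
  exists (f a); apply: xget_unique => // c [cb fc].
  by apply: finj => //; rewrite inE.
by move=> i; case: xgetP => // c _ [].
Qed.

(** Closure points stand in for traces on omega_1 of countable elementary
    submodels: [dl] is a limit, and nothing that [g] computes from an argument
    below [dl] escapes [dl].  All reflection arguments are cast as the choice
    of one function [g]. *)
Definition closed_under (g : W -> W) (dl : W) : Prop :=
  (exists z, z < dl) /\
  forall z, z < dl -> exists z', [/\ z < z', g z < z' & z' < dl].

(** The supremum of an increasing sequence, each of whose terms bounds [g] on
    the countable initial segment up to the previous one. *)
Lemma closure_point (g : W -> W) : exists dl, closed_under g dl.
Proof.
have [_ _ cI] := W1.
have up x : exists y, x < y /\ forall z, z <= x -> g z < y.
  have [h xh] := countable_bounded (countable1 x).
  have [h1 hh1] := countable_bounded (countable1 h).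
  have [|y yP] := @countable_bounded (g @` [set z | z < h]).
    exact: sub_countable (card_image_le _ _) (cI h).
  exists (Order.max y h); split=> [|z zx]; rewrite lt_max.
    by rewrite (xh x erefl) orbT.
  by rewrite yP//; exists z => //=; rewrite (le_lt_trans zx)// xh.
have [nx nxP] := choice up.
have [b _] := countable_bounded (countable0 W).
pose u k := iter k nx b.
have [h uh] := seq_bounded u.
have [dl dlP dlmin] := @omega1_least [set h | forall k, u k < h] (ex_intro _ h uh).
have {}dlP k : u k < dl by exact: dlP.
exists dl; split; first by exists (u 0%N).
move=> z zdl.
have [k zk] : exists k, z <= u k.
  apply: contrapT => /forallNP nk; have : dl <= z.
    by apply: dlmin => k /=; rewrite ltNge; exact/negP.
  by rewrite leNgt zdl.
have [uk ukP] := nxP (u k); exists (u k.+1); split; last exact: dlP.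
- exact: le_lt_trans zk uk.
- exact: ukP.
Qed.

End Omega1.

(** * Walks, their weights and their lower traces *)

Section Walks.
Context {d : Order.disp_t} {W : orderType d}.
Variables (W1 : is_omega1 W) (w0 : W) (w0P : forall x, w0 <= x).
Variables (e : W -> nat -> W) (eP : enumerates e).
Implicit Types (a b c x y : W).

(** The points of [e b] that exceed all earlier ones form a cofinal subset
    C_b of the predecessors of [b], of order type at most omega.  Stopping at
    the first [e b i >= a] selects the least element of C_b that is at least
    [a], so this is the usual walk along the C_b; indexing by [i] treats limit
    and successor points alike. *)
Definition walk_index b a : nat :=
  xget 0%N [set i | a <= e b i /\ forall j, (j < i)%N -> e b j < a].

Definition walk_step b a : W := e b (walk_index b a).

Lemma walk_indexP b a : a < b ->
  a <= walk_step b a /\ forall j, (j < walk_index b a)%N -> e b j < a.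
Proof.
move=> ab; have [[i ei] _] := eP ab.
have exi : exists i, a <= e b i by exists i; rewrite ei.
apply: (@xgetPex _ 0%N [set i | a <= e b i /\ forall j, (j < i)%N -> e b j < a]).
case: (ex_minnP exi) => k ak kmin; exists k; split=> // j jk.
by rewrite ltNge; apply/negP => /kmin; rewrite leqNgt jk.
Qed.

Lemma walk_index_unique b a i : a <= e b i ->
  (forall j, (j < i)%N -> e b j < a) -> walk_index b a = i.
Proof.
move=> ai imin; apply: xget_unique => // j [aj jmin].
have [ij|ji|//] := ltngtP i j.
  by have := jmin _ ij; rewrite ltNge ai.
by have := imin _ ji; rewrite ltNge aj.
Qed.

Lemma walk_step_ge b a : a < b -> a <= walk_step b a.
Proof. by case/walk_indexP. Qed.

Lemma walk_step_lt b a : a < b -> walk_step b a < b.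
Proof. by move=> ab; have [_] := eP ab; apply. Qed.

(** The points visited by the walk from [b] to [a], excluding [a].  The inner
    test only supplies the termination proof. *)
Definition trace (a : W) : W -> seq W :=
  Fix (omega1_wf W1) (fun=> seq W) (fun b rec =>
    if a < b then
      b :: match boolP (walk_step b a < b) with
           | AltTrue h => rec (walk_step b a) h
           | AltFalse _ => [::]
           end
    else [::]).

Lemma traceE a b :
  trace a b = if a < b then b :: trace a (walk_step b a) else [::].
Proof.
rewrite {1}/trace Fix_eq => [|y f g fg].
  case: ifP => // ab; congr (_ :: _).
  by case: {-}_ / boolP => // /negP[]; exact: walk_step_lt.
by case: ifP => // _; case: {-}_ / boolP => // h; rewrite fg.
Qed.

Lemma trace_cons a b : a < b -> trace a b = b :: trace a (walk_step b a).
Proof. by move=> ab; rewrite traceE ab. Qed.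

Lemma trace_nil a b : b <= a -> trace a b = [::].
Proof. by move=> ba; rewrite traceE ltNge ba. Qed.

Lemma walk_ind a (P : W -> Prop) : P a ->
  (forall b, a < b -> P (walk_step b a) -> P b) -> forall b, a <= b -> P b.
Proof.
move=> Pa IH b; elim/(well_founded_ind (omega1_wf W1)): b => b IHb.
rewrite le_eqVlt => /predU1P[<-//|ab]; apply: IH => //.
by apply: IHb; [exact: walk_step_lt|exact: walk_step_ge].
Qed.

Lemma mem_trace a b c : c \in trace a b -> a < c.
Proof.
have [ab|/trace_nil->//] := ltP a b.
elim/walk_ind: (ltW ab) => {ab} [|{}b ab IH]; first by rewrite trace_nil.
by rewrite trace_cons// inE => /predU1P[->//|/IH].
Qed.

(** Todorcevic's function rho_1, the maximal weight along the walk, written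
    with the upper endpoint first so that [weight b] is the function attached
    to [b]. *)
Definition weight b a : nat := \max_(c <- trace a b) walk_index c a.

Lemma weightE b a : a < b ->
  weight b a = maxn (walk_index b a) (weight (walk_step b a) a).
Proof. by move=> ab; rewrite /weight trace_cons// big_cons. Qed.

(** If the weight is at most [n], the first step of the walk leads to one of the
    finitely many points [e b 0], ..., [e b n], each of which contributes
    finitely many [a] by induction. *)
Lemma weight_finite_to_one b n : finite_set [set a | a < b /\ (weight b a <= n)%N].
Proof.
elim/(well_founded_ind (omega1_wf W1)): b => b IH.
apply: (@sub_finite_set _ _
  (\bigcup_(i in `I_n.+1) ([set e b i] `|`
     [set a | e b i < b /\ (a < e b i /\ (weight (e b i) a <= n)%N)]))).
  move=> a [ab]; rewrite weightE// geq_max => /andP[ni nw].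
  exists (walk_index b a) => //=.
  have := walk_step_ge ab; rewrite le_eqVlt => /predU1P[aE|ac]; first by left.
  by right; split; [exact: (walk_step_lt ab)|split; [exact: ac|exact: nw]].
apply: bigcup_finite; first exact: finite_II.
move=> i _; rewrite finite_setU; split; first exact: finite_set1.
have [ib|nib] := pselect (e b i < b).
  by apply: sub_finite_set (IH _ ib) => a [].
by apply: sub_finite_set (finite_set0 W) => a [].
Qed.

(** If [c = e b N], then for [a < c] the first step leads to some [e b i] with
    [i <= N].  There [weight b a] is [weight (e b i) a] except at the finitely
    many [a] where this is below [i], and [weight (e b i)] and [weight c]
    nearly agree by induction. *)
Lemma weight_coherent b c : c <= b ->
  finite_set [set a | a < c /\ weight b a <> weight c a].
Proof.
elim/(well_founded_ind (omega1_wf W1)): b c => b IH c.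
rewrite le_eqVlt => /predU1P[->|cb].
  by apply: sub_finite_set (finite_set0 W) => a [_] /(_ erefl).
have coh x y : x < b -> y < b ->
    finite_set [set a | [/\ a < x, a < y & weight x a <> weight y a]].
  move=> xb yb; have [xy|yx] := leP x y.
    by apply: sub_finite_set (IH _ yb _ xy) => a [ax _ ne]; split=> // /esym.
  by apply: sub_finite_set (IH _ xb _ (ltW yx)) => a [].
have [[N eN] eb] := eP cb.
apply: (@sub_finite_set _ _
  (\bigcup_(i in `I_N.+1) ([set e b i] `|`
     ([set a | a < e b i /\ (weight (e b i) a <= i)%N] `|`
      [set a | [/\ a < e b i, a < c & weight (e b i) a <> weight c a]])))).
  move=> a [ac]; have ab := lt_trans ac cb; rewrite weightE//.
  move=> ne; exists (walk_index b a) => /=.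
    rewrite ltnS leqNgt; apply/negP => Ni.
    by have [_ /(_ _ Ni)] := walk_indexP ab; rewrite eN ltNge (ltW ac).
  have := walk_step_ge ab; rewrite le_eqVlt => /predU1P[aE|ad]; first by left.
  right; have [wi|iw] := leqP (weight (walk_step b a) a) (walk_index b a).
    by left.
  by right; split=> // we; apply: ne; rewrite -we; apply/maxn_idPr/ltnW.
apply: bigcup_finite; first exact: finite_II.
move=> i _; rewrite !finite_setU; split; first exact: finite_set1.
by split; [exact: weight_finite_to_one|exact: coh].
Qed.

(** The largest element of C_b below [a]; [w0], the least point, stands for the
    maximum of the empty set. *)
Definition walk_low b a : W := \big[Order.max/w0]_(i < walk_index b a) e b i.

Lemma walk_low_lt b a c : a < b -> c < a -> walk_low b a < a.
Proof.
move=> ab ca; rewrite /walk_low; elim/big_ind: _ => [|x y xa ya|i _].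
- exact: le_lt_trans ca.
- by rewrite gt_max xa.
- by have [_] := walk_indexP ab; apply.
Qed.

Lemma walk_low_sup b a i : (i < walk_index b a)%N -> e b i <= walk_low b a.
Proof. by move=> ib; exact: (le_bigmax w0 (fun i : 'I__ => e b i) (Ordinal ib)). Qed.

(** Running maxima, rather than the points [walk_low c a] themselves, ensure
    that the first of them bounds all of [lower a b] from below. *)
Definition lower a b : seq W :=
  scanl Order.max w0 [seq walk_low c a | c <- trace a b].

(** The point [c] only says that [a] is not the least point. *)
Lemma lower_lt a b c : c < a -> all (< a) (lower a b).
Proof.
move=> ca.
have : all (< a) [seq walk_low c a | c <- trace a b].
  by apply/allP => _ /mapP[x /mem_trace ax ->]; exact: walk_low_lt ca.
have : w0 < a by exact: le_lt_trans ca.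
rewrite /lower; elim: [seq _ | _ <- _] w0 => //= y s IH w wa /andP[ya sa].
by rewrite gt_max wa ya /= IH// gt_max wa.
Qed.

Lemma scanl_max_lt (a w : W) s : all (< a) (scanl Order.max w s) -> all (< a) s.
Proof.
by elim: s w => //= y s IH w /andP[]; rewrite gt_max => /andP[_ ->] /IH.
Qed.

Lemma foldl_max_lt (a w : W) s : w < a -> all (< a) s -> foldl Order.max w s < a.
Proof.
by elim: s w => //= y s IH w wa /andP[ya sa]; apply: IH => //; rewrite gt_max wa.
Qed.

Lemma scanl_max_ge (w : W) s : all (>= w) (scanl Order.max w s).
Proof.
elim: s w => //= y s IH w; rewrite le_max lexx /=.
by apply: sub_all (IH _) => z; apply: le_trans; rewrite le_max lexx.
Qed.

(** While the walk from [b] to [dl] is in progress, no C_c has a point in the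
    interval from [a] to [dl], so the walk from [b] to [a] takes the same
    steps until it arrives at [dl]. *)
Lemma walk_cat a dl b : a < dl -> dl <= b ->
  all (< a) [seq walk_low c dl | c <- trace dl b] ->
  trace a b = trace dl b ++ trace a dl /\
  [seq walk_low c a | c <- trace dl b] = [seq walk_low c dl | c <- trace dl b].
Proof.
move=> adl; elim/walk_ind: b / => [|b dlb IH]; first by rewrite trace_nil.
have ab := lt_trans adl dlb.
rewrite (trace_cons dlb) /= => /andP[lowa /IH[tr lw]].
have ei : walk_index b a = walk_index b dl.
  apply: walk_index_unique; first exact: le_trans (ltW adl) (walk_step_ge dlb).
  by move=> j /walk_low_sup jl; exact: le_lt_trans lowa.
have es : walk_step b a = walk_step b dl by rewrite /walk_step ei.
by rewrite (trace_cons ab) es tr lw {1}/walk_low ei.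
Qed.

(** [eta] separates the two pieces: the running maximum accumulated on the way
    to [dl] stays below [eta], hence is absorbed by the first point of
    [lower a dl]. *)
Lemma lower_cat eta a dl b : a < dl -> dl <= b -> w0 < eta -> eta < a ->
  all (< eta) (lower dl b) -> eta <= walk_low dl a ->
  lower a b = lower dl b ++ lower a dl.
Proof.
move=> adl dlb w0e ea lowe ela.
have lowe' := scanl_max_lt lowe.
have [|tr lw] := walk_cat adl dlb.
  by apply: sub_all lowe' => z /lt_trans; apply.
rewrite {1}/lower tr map_cat scanl_cat lw; congr (_ ++ _).
rewrite /lower (trace_cons adl) /=.
suff -> : Order.max (foldl Order.max w0 [seq walk_low c dl | c <- trace dl b])
  (walk_low dl a) = Order.max w0 (walk_low dl a) by [].
rewrite (max_r (w0P _)); apply: max_r; apply: ltW.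
exact: lt_le_trans (foldl_max_lt w0e lowe') ela.
Qed.

(** Membership in C_dl.  A walk from [dl] to a point above such an [eta] has its
    lower trace at or above [eta]. *)
Definition record dl eta : Prop :=
  exists i, e dl i = eta /\ forall j, (j < i)%N -> e dl j <= eta.

Lemma walk_step_record dl z : z < dl -> record dl (walk_step dl z).
Proof.
move=> zdl; exists (walk_index dl z); split=> // j.
have [zs /[apply]] := walk_indexP zdl => /ltW jz; exact: le_trans zs.
Qed.

Lemma record_low dl eta a : record dl eta -> eta < a -> a < dl ->
  eta <= walk_low dl a.
Proof.
move=> [i [ei imin]] ea adl.
have [as_ _] := walk_indexP adl.
rewrite -ei; apply: walk_low_sup; rewrite ltnNge leq_eqVlt; apply/negP.
have le_e j : (j <= i)%N -> e dl j <= eta.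
  by rewrite leq_eqVlt => /predU1P[->|/imin//]; rewrite ei.
rewrite -leq_eqVlt => /le_e ie.
by have := lt_le_trans ea as_; rewrite ltNge ie.
Qed.

Lemma lower_ge dl eta a : eta <= walk_low dl a -> a < dl ->
  all (>= eta) (lower a dl).
Proof.
move=> el adl; rewrite /lower (trace_cons adl) /=.
have h : eta <= Order.max w0 (walk_low dl a) by rewrite le_max el orbT.
rewrite h /=; apply: sub_all (scanl_max_ge _ _) => z; exact: le_trans.
Qed.

Lemma lower_neq0 a dl : a < dl -> lower a dl != [::].
Proof. by move=> adl; rewrite /lower (trace_cons adl). Qed.

End Walks.

(** * Reflection at closure points *)

Section Reflection.
Context {d : Order.disp_t} {W : orderType d} (W1 : is_omega1 W).
Implicit Types (dl eta z : W) (g : W -> W).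

Lemma closed_under_le g g' dl :
  (forall z, g' z <= g z) -> closed_under g dl -> closed_under g' dl.
Proof.
move=> gg' [ex cl]; split=> // z /cl[z' [zz' gz z'dl]].
by exists z'; split=> //; exact: le_lt_trans gz.
Qed.

Lemma closed_lt g dl z : closed_under g dl -> z < dl -> g z < dl.
Proof. by move=> [_ cl] /cl[z' [_ /lt_trans]]; apply. Qed.

(** Closure points are limits. *)
Lemma closed_finite_bound g dl (F : set W) : closed_under g dl ->
  finite_set F -> exists2 z, z < dl & forall x, F x -> x < dl -> x < z.
Proof.
move=> [[z0 z0dl] cl] /finite_seqP[s ->].
elim: s => [|y s [z zdl zP]]; first by exists z0.
have [ydl|dly] := ltP y dl; last first.
  exists z => // x /=; rewrite inE => /predU1P[->|]; last exact: zP.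
  by rewrite ltNge dly.
have [z' [yz' _ z'dl]] := cl _ ydl.
exists (Order.max z z'); first by rewrite gt_max zdl.
move=> x /=; rewrite inE => /predU1P[->|xs] xdl; rewrite lt_max.
  by rewrite yz' orbT.
by rewrite zP.
Qed.

(** A substitute for elementarity.  For fixed [eta], the objects with a given
    code either have unbounded heights, or their heights are bounded by a point
    that depends on [eta] and the code only.  As there are countably many codes,
    these bounds, and the heights of chosen witnesses, stay below a closure
    point [dl > eta].  So an object of height at least [dl] shows that its code
    is of the unbounded kind. *)
Lemma reflection (S : Type) (ht : S -> W) (P : W -> S -> Prop)
    (code : W -> S -> nat) :
  exists g, forall dl, closed_under g dl -> forall eta s,
    eta < dl -> P eta s -> dl <= ht s ->
    (forall h, exists t, [/\ P eta t, code eta t = code eta s & h < ht t]) /\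
    exists t, [/\ P eta t, code eta t = code eta s, eta < ht t & ht t < dl].
Proof.
have ex (p : W * nat) : exists u,
    let Q h t := [/\ P p.1 t, code p.1 t = p.2 & h < ht t] in
    ((forall h, exists t, Q h t) /\ exists2 t, Q p.1 t & ht t < u) \/
    ~ exists t, Q u t.
  set Q := fun h t => [/\ P p.1 t, code p.1 t = p.2 & h < ht t].
  have [all|/existsNP[h nh]] := pselect (forall h, exists t, Q h t); last first.
    by exists h; right.
  have [t Qt] := all p.1; have [u tu] := seq_bounded W1 (fun _ : unit => ht t).
  by exists u; left; split=> //; exists t => //; exact: (tu tt).
have [u uP] := choice ex.
have /choice[g gP] eta : exists h, forall k, u (eta, k) < h.
  by have [h] := seq_bounded W1 (fun k => u (eta, k)); exists h.
exists g => dl cl eta s eta_dl Ps dls.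
have udl : u (eta, code eta s) < dl.
  exact: lt_trans (gP _ _) (closed_lt cl eta_dl).
case: (uP (eta, code eta s)) => /= [[all [t [Pt ct et] tu]]|[]].
  by split=> //; exists t; split=> //; exact: lt_trans udl.
by exists s; split=> //; exact: lt_le_trans dls.
Qed.

End Reflection.

(** * Counting switches *)

(** The number of switches from [false] to [true] in the sequence [p :: s]. *)
Fixpoint rises (p : bool) (s : seq bool) : nat :=
  if s is q :: s' then (~~ p && q) + rises q s' else 0.

Lemma rises_cat p s t : rises p (s ++ t) = (rises p s + rises (last p s) t)%N.
Proof. by elim: s p => //= q s IH p; rewrite IH addnA. Qed.

Lemma rises_const p r s : all (pred1 r) s -> s != [::] ->
  rises p s = ~~ p && r /\ last p s = r.
Proof.
case: s => //= q s /andP[/eqP-> sr] _.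
have [-> ->] : rises r s = 0%N /\ last r s = r; last by rewrite addn0.
by elim: s sr => //= y s IH /andP[/eqP-> /IH[-> ->]]; rewrite andNb.
Qed.

(** The witness is [c + m + 1 = k 2^(i+1) + 2^i] for the least [k] that makes
    the first summand exceed [c]. *)
Lemma logn2_interval (i c : nat) :
  exists2 m, (m <= 2 ^ i.+2)%N & logn 2 (c + m).+1 = i.
Proof.
pose q := (2 ^ i.+1)%N; have q0 : (0 < q)%N by rewrite expn_gt0.
pose k := ((c %/ q).+1)%N.
have ck : (c < k * q)%N by exact: ltn_ceil.
have kc : (k * q <= c + q)%N.
  by rewrite /k mulSn addnC leq_add2r leq_divM.
have i0 : (0 < 2 ^ i)%N by rewrite expn_gt0.
have qE : q = (2 * 2 ^ i)%N by rewrite /q expnS.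
exists (k * q + 2 ^ i - c.+1)%N.
  rewrite expnS -/q; lia.
have -> : (c + (k * q + 2 ^ i - c.+1)).+1 = (2 ^ i * (k * 2).+1)%N by lia.
rewrite lognM// pfactorK// logn_coprime ?addn0//.
by rewrite coprime2n /= muln2 odd_double.
Qed.

(** * Oscillation of weights along lower traces *)

Section Oscillation.
Context {d : Order.disp_t} {W : orderType d}.
Variables (W1 : is_omega1 W) (w0 : W) (w0P : forall x, w0 <= x).
Variables (e : W -> nat -> W) (eP : enumerates e).
Implicit Types (a b c x y z dl eta : W) (A B : set W).

Local Notation wt := (weight W1 e).
Local Notation L := (lower W1 w0 e).

Definition position z x : nat := xget 0%N [set i | e z i = x].

Lemma positionK z x : x < z -> e z (position z x) = x.
Proof.
by case/eP => -[i ei] _; apply: (@xgetPex _ 0%N [set i | e z i = x]); exists i.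
Qed.

Definition agree_below z a b : Prop := forall x, x < z -> wt a x = wt b x.

(** Coherence makes the set of restrictions of the weights to the predecessors
    of [z] countable: such a restriction is determined by its finite difference
    from [weight z]. *)
Lemma restriction_code : exists code : W -> W -> nat,
  forall z a b, z <= a -> z <= b ->
    code z a = code z b <-> agree_below z a b.
Proof.
pose res z a x := if x < z then wt a x else 0%N.
have cres z : countable [set res z a | a in [set a | z <= a]].
  have dfin a : z <= a -> exists s : seq W,
      forall x, x \in s <-> x < z /\ res z a x <> wt z x.
    move=> za; have /finite_seqP[s sE] := weight_coherent W1 eP za.
    exists s => x; have -> : (x \in s) = ([set` s] x) :> Prop by [].
    by rewrite -sE /res /=; split=> -[xz]; rewrite xz.
  pose dif (r : W -> nat) (s : seq W) :=
    forall x, x \in s <-> x < z /\ r x <> wt z x.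
  have dif1 (r : W -> nat) : exists s : seq W, (exists s, dif r s) -> dif r s.
    have [[s sP]|n] := pselect (exists s, dif r s); first by exists s.
    by exists [::] => /n.
  have [D DP] := choice dif1.
  apply/countable_injP.
  exists (fun r => pickle [seq (position z x, r x) | x <- D r]) => r r'.
  rewrite !inE => -[a za <-{r}] [a' za' <-{r'}] /(pcan_inj pickleK) eq.
  have Da := DP _ (dfin a za); have Da' := DP _ (dfin a' za').
  have half b b' : dif (res z b) (D (res z b)) -> dif (res z b') (D (res z b')) ->
      [seq (position z x, res z b x) | x <- D (res z b)] =
      [seq (position z x, res z b' x) | x <- D (res z b')] ->
      forall x, x < z -> res z b x <> wt z x -> res z b x = res z b' x.
    move=> Db Db' eqb x xz ne.
    have /(map_f (fun x => (position z x, res z b x))) : x \in D (res z b).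
      exact/Db.
    rewrite eqb => /mapP[y /Db'[yz _]] [] pxy ->.
    by rewrite -(positionK xz) pxy positionK.
  apply/funext => x; rewrite /res; case: ifP => // xz.
  have resE b : res z b x = wt b x by rewrite /res xz.
  have ha := half _ _ Da Da' eq x xz; have hb := half _ _ Da' Da (esym eq) x xz.
  rewrite !resE in ha hb.
  have [ea|/eqP/ha//] := eqVneq (wt a x) (wt z x).
  by have [->//|/eqP/hb//] := eqVneq (wt a' x) (wt z x).
have cinj z : exists f : (W -> nat) -> nat,
    {in [set res z a | a in [set a | z <= a]] &, injective f}.
  exact/countable_injP.
have [f fP] := choice cinj.
exists (fun z a => f z (res z a)) => z a b za zb; split=> [/fP eq x xz|eq].
  have : res z a = res z b by apply: eq; rewrite inE; [exists a|exists b].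
  by move=> /(congr1 (@^~ x)); rewrite /res xz.
congr (f z _); apply/funext => x; rewrite /res; case: ifP => // xz; exact: eq.
Qed.

(** By finiteness of the fibres, [weight a > n] holds from some [th < dl] up to
    [dl].  Reflection turns this into: for all [h] some [a'] with the code of
    [a] at [z] has weight above [n] from [th] up to [h].  Now [th] may be
    chosen to depend on [z], [n] and the code only, and [g z] bounds it for all
    codes and all [n].  That the bound is independent of [n] is essential: [n]
    will be the maximum of a weight on a block whose position depends on
    [g z]. *)
Lemma high_extension A : exists g, forall dl, closed_under g dl ->
  forall z a n, z < dl -> A a -> dl <= a ->
  exists a', [/\ A a', dl <= a', agree_below z a' a &
    forall x, g z <= x -> x < dl -> (n < wt a' x)%N].
Proof.
have [code codeP] := restriction_code.
pose high n th h a := forall x, th <= x -> x < h -> (n < wt a x)%N.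
have [g0 g0P] := reflection W1 (fun s : nat * W * W => s.1.2)
  (fun th s => [/\ A s.2, th <= s.1.2, s.1.2 <= s.2 & high s.1.1 th s.1.2 s.2])
  (fun th s => pickle (s.1.1, code th s.2)).
(* [k] pairs a code at [z] with a lower bound for the weight. *)
pose H z (k : nat * nat) th := forall h, exists a,
  [/\ A a, z <= a, h <= a, code z a = k.1 & high k.2 th h a].
have exth (p : W * (nat * nat)) : exists th,
    (exists th, H p.1 p.2 th) -> H p.1 p.2 th.
  have [[th thP]|n] := pselect (exists th, H p.1 p.2 th); first by exists th.
  by exists w0 => /n.
have [th thP] := choice exth.
have /choice[h hP] z : exists h, forall k, th (z, k) < h.
  exact: (seq_bounded W1 (fun k => th (z, k))).
exists (fun z => Order.max (g0 z) (h z)) => dl cl z a n zdl Aa dla.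
have cl0 : closed_under g0 dl.
  by apply: closed_under_le cl => y; rewrite le_max lexx.
have [y ydl yP] := closed_finite_bound cl (weight_finite_to_one W1 eP a n).
pose t := Order.max y z.
have tdl : t < dl by rewrite gt_max ydl.
have zt : z <= t by rewrite le_max lexx orbT.
have [|up _] := g0P _ cl0 t (n, dl, a) tdl _ (lexx dl).
  split=> //=; first exact: ltW.
  move=> x; rewrite ge_max => /andP[yx _] xdl; rewrite ltnNge; apply/negP => xn.
  have /yP/(_ xdl) : x < a /\ (wt a x <= n)%N by split=> //; exact: lt_le_trans dla.
  by rewrite ltNge yx.
have Hex : H z (code z a, n) t.
  move=> k; have [[[n' k'] a'] /=] := up (Order.max k dl).
  move=> [[Aa' tk' ka' hi]] /(pcan_inj pickleK)[nn ca]; rewrite gt_max => /andP[kk' dlk'].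
  have ta' : t <= a' by exact: le_trans ka'.
  exists a'; split=> //=.
  - exact: le_trans ta'.
  - exact: le_trans (ltW kk') ka'.
  - apply/codeP => //; [exact: le_trans ta'|exact: le_trans (ltW zdl) dla|].
    have /codeP ag := ca.
    move=> x xz; apply: ag => //; first exact: le_trans (ltW tdl) dla.
    exact: lt_le_trans zt.
  - rewrite -nn => x tx xk; apply: hi => //; exact: lt_trans kk'.
have [a' [Aa' za' dla' ca' hi]] := thP (z, (code z a, n)) (ex_intro _ t Hex) dl.
exists a'; split=> //.
  by apply/codeP => //; exact: le_trans (ltW zdl) dla.
move=> x; rewrite ge_max => /andP[_ hx] xdl; apply: hi => //.
exact: le_trans (ltW (hP _ _)) hx.
Qed.

Definition exceeds a b (s : seq W) : seq bool := [seq (wt b x < wt a x)%N | x <- s].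

(** The triple [dl, a, b] is reflected above [dl], to [dl1, a1, b1], keeping the
    restrictions to [eta], the list [lower dl b], the agreement of the weights
    from [eta] on, and a point [eta] of C_dl.  Concatenation at [dl1] then shows
    that [lower dl b1] ends with the block [K = lower dl dl1], which lies
    between [eta] and [dl].  There [a1] and [b1] have equal weights, which is the
    case [r = false]; for [r = true] a high extension of [a] is used instead of
    [a1]. *)
Lemma oscillation_step A B : exists g, forall dl, closed_under g dl ->
  forall th (r : bool) a b, th < dl -> A a -> B b -> dl <= a -> dl <= b ->
  exists a' b' K,
    [/\ [/\ A a', B b', dl <= a' & dl <= b'],
        agree_below th a' a, agree_below th b' b,
        L dl b' = L dl b ++ K /\ K != [::] &
        all (pred1 r) (exceeds a' b' K) /\ exceeds a' b' (L dl b) = exceeds a b (L dl b)].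
Proof.
have [code codeP] := restriction_code.
have [gh ghP] := high_extension A.
pose P eta (s : W * W * W) := let dl := s.1.1 in let a := s.1.2 in let b := s.2 in
  [/\ [/\ A a, B b, dl <= a & dl <= b],
      forall x, eta <= x -> x < dl -> wt a x = wt dl x /\ wt b x = wt dl x,
      all (< eta) (L dl b), eta < dl & record e dl eta].
have [g0 g0P] := reflection W1 (fun s : W * W * W => s.1.1) P
  (fun eta s => pickle (code eta s.1.2, code eta s.2,
    [seq position eta x | x <- L s.1.1 s.2])).
exists (fun z => Order.max (g0 z) (gh z)) => dl cl th r a b thdl Aa Bb dla dlb.
have cl0 : closed_under g0 dl.
  by apply: closed_under_le cl => y; rewrite le_max lexx.
have clh : closed_under gh dl.
  by apply: closed_under_le cl => y; rewrite le_max lexx orbT.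
have [[z0 z0dl] lim] := cl.
have [za zadl zaP] := closed_finite_bound cl (weight_coherent W1 eP dla).
have [zb zbdl zbP] := closed_finite_bound cl (weight_coherent W1 eP dlb).
have [zl zldl zlP] := closed_finite_bound cl (finite_seq (L dl b)).
have Llt : all (< dl) (L dl b) by apply: (lower_lt W1 w0P eP b z0dl).
(* All of [th], the disagreements of the weights and [lower dl b] lie below
   [z]; [eta] in C_dl is above [z] and above the threshold for high
   extensions at [z]. *)
pose z := Order.max (Order.max za zb) (Order.max zl th).
have zdl : z < dl by rewrite !gt_max zadl zbdl zldl.
pose y := Order.max z (gh z).
have ydl : y < dl by rewrite gt_max zdl (closed_lt clh).
have [y' [yy' _ y'dl]] := lim _ ydl.
pose eta := walk_step e dl y'.
have eta_dl : eta < dl by exact: (walk_step_lt eP y'dl).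
have y_eta : y < eta by exact: lt_le_trans yy' (walk_step_ge eP y'dl).
have z_eta : z < eta by apply: le_lt_trans y_eta; rewrite le_max lexx.
have ghz_eta : gh z < eta by apply: le_lt_trans y_eta; rewrite le_max lexx orbT.
have ge_z x : z <= x -> [/\ za <= x, zb <= x, zl <= x & th <= x].
  by rewrite !ge_max => /andP[/andP[-> ->] /andP[-> ->]].
have [] := ge_z _ (ltW z_eta) => za_eta zb_eta zl_eta th_eta.
have Llt_z : all (< z) (L dl b).
  apply/allP => x xL; have xdl := allP Llt _ xL.
  by rewrite /z /= !lt_max (zlP _ xL xdl) orbT.
have Pdl : P eta (dl, a, b).
  split=> //=.
  - move=> x ex xdl; split; apply: contrapT => ne.
      have := zaP x (conj xdl ne) xdl.
      by rewrite ltNge (le_trans za_eta ex).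
    have := zbP x (conj xdl ne) xdl.
    by rewrite ltNge (le_trans zb_eta ex).
  - by apply: sub_all Llt_z => x /lt_trans; apply.
  - exact: walk_step_record.
have [up _] := g0P _ cl0 eta (dl, a, b) eta_dl Pdl (lexx _).
have [[[dl1 a1] b1] [/= [/= [Aa1 Bb1 dla1 dlb1] ag1 L1lt edl1 rec1] ceq dldl1]] := up dl.
have /(pcan_inj pickleK)[ca cb cL] := ceq.
have La : L dl1 b1 = L dl b.
  have : map (e eta) (map (position eta) (L dl1 b1)) =
         map (e eta) (map (position eta) (L dl b)) by rewrite cL.
  rewrite -!map_comp !map_id_in // => x.
    by move=> xL; rewrite /= positionK//; case: Pdl => _ _ /allP/(_ x xL).
  by move=> xL; rewrite /= positionK//; exact: (allP L1lt).
have dla1' := le_trans (ltW dldl1) dla1.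
have dlb1' := le_trans (ltW dldl1) dlb1.
have aga : agree_below eta a1 a.
  apply/codeP => //; [exact: le_trans (ltW edl1) dla1|exact: le_trans (ltW eta_dl) dla].
have agb : agree_below eta b1 b.
  apply/codeP => //; [exact: le_trans (ltW edl1) dlb1|exact: le_trans (ltW eta_dl) dlb].
have low1 := record_low w0 eP rec1 eta_dl dldl1.
have w0eta : w0 < eta by exact: le_lt_trans (w0P z) z_eta.
have Lb1 : L dl b1 = L dl b ++ L dl dl1.
  by rewrite (lower_cat w0P eP dldl1 dlb1 w0eta eta_dl L1lt low1) La.
have Kge := lower_ge W1 eP low1 dldl1.
have Klt : all (< dl) (L dl dl1) by apply: (lower_lt W1 w0P eP dl1 z0dl).
have K0 := lower_neq0 W1 w0 eP dldl1.
have agb_th : agree_below th b1 b by move=> x xt; apply: agb; exact: lt_le_trans th_eta.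
have th_z : th <= z by have [] := ge_z z (lexx z).
have cmp a' : agree_below z a' a -> exceeds a' b1 (L dl b) = exceeds a b (L dl b).
  move=> ag'; apply/eq_in_map => x /(allP Llt_z) xz.
  by rewrite ag'// agb//; exact: lt_trans z_eta.
case: r.
- pose n := \max_(x <- L dl dl1) wt b1 x.
  have [a2 [Aa2 dla2 ag2 hi]] := ghP _ clh z a n zdl Aa dla.
  exists a2, b1, (L dl dl1); split=> //.
    by move=> x xt; apply: ag2; exact: lt_le_trans th_z.
  split; last exact: cmp.
  rewrite all_map; apply/allP => x xK /=; rewrite eqb_id.
  apply: leq_ltn_trans (hi x _ (allP Klt _ xK)).
    exact: leq_bigmax_seq.
  exact: le_trans (ltW ghz_eta) (allP Kge _ xK).
- exists a1, b1, (L dl dl1); split=> //.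
    by move=> x xt; apply: aga; exact: lt_le_trans th_eta.
  split; last by apply: cmp => x xz; apply: aga; exact: lt_trans z_eta.
  rewrite all_map; apply/allP => x xK /=.
  have [-> ->] := ag1 x (allP Kge _ xK) (lt_trans (allP Klt _ xK) dldl1).
  by rewrite ltnn.
Qed.

Definition osc a b : nat := rises false (exceeds a b (L a b)).

(** Induction on [N].  The pair of [a] and the last [b m] is extended by one
    step with comparison [false] and one step with comparison [true], which
    together create exactly one rise; as the new [a] has the same weights as the
    old one on the lower traces of the previous [b m], their counts do not
    change.  Ending on [true] for every [m] makes what is appended later
    contribute the same number of rises for every [m]. *)
Lemma oscillation_at_closed A B : unbounded A -> unbounded B ->
  exists g, forall dl, closed_under g dl -> forall N : nat,
  exists a (b : nat -> W) (c : nat),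
    [/\ A a, dl <= a, forall m, (m <= N)%N -> B (b m) /\ dl <= b m &
     forall m, (m <= N)%N ->
       rises false (exceeds a (b m) (L dl (b m))) = (c + m)%N /\
       last false (exceeds a (b m) (L dl (b m))) = true].
Proof.
move=> uA uB; have [g gP] := oscillation_step A B.
exists g => dl cl; have [[z0 z0dl] _] := cl.
have bnd (b : W) : exists2 z, z < dl & all (< z) (L dl b).
  have [z zdl zP] := closed_finite_bound cl (finite_seq (L dl b)).
  exists z => //; apply/allP => x xL; apply: zP => //.
  exact: (allP (lower_lt W1 w0P eP b z0dl)).
elim=> [|N [a [b [c [Aa dla Bb osb]]]]].
  have [a Aa dla] := uA dl; have [b Bb dlb] := uB dl.
  have [a' [b' [K [[Aa' Bb' dla' dlb'] aga agb [LK K0] [cK cL]]]]] :=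
    gP _ cl z0 true a b z0dl Aa Bb (ltW dla) (ltW dlb).
  have cK0 : exceeds a' b' K != [::] by case: (K) K0.
  exists a', (fun=> b'), (rises false (exceeds a' b' (L dl b'))).
  split=> // m; rewrite leqn0 => /eqP->; rewrite addn0; split=> //.
  rewrite LK /exceeds map_cat last_cat.
  by have [_] := rises_const (last false (exceeds a' b' (L dl b))) cK cK0.
have [z zdl zP] : exists2 z, z < dl &
    forall m, (m <= N)%N -> all (< z) (L dl (b m)).
  elim: (N) => [|M [z zdl zP]].
    have [z zdl zP] := bnd (b 0%N); exists z => // m.
    by rewrite leqn0 => /eqP->.
  have [z' z'dl z'P] := bnd (b M.+1).
  exists (Order.max z z'); first by rewrite gt_max zdl.
  move=> m; rewrite leq_eqVlt => /predU1P[->|mM].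
    by apply: sub_all z'P => x /= xz; rewrite lt_max xz orbT.
  by apply: sub_all (zP m mM) => x /= xz; rewrite lt_max xz.
have [BN dlN] := Bb N (leqnn N).
have [a1 [b1 [K1 [[Aa1 Bb1 dla1 dlb1] aga1 agb1 [LK1 K10] [cK1 cL1]]]]] :=
  gP _ cl z false a (b N) zdl Aa BN dla dlN.
have [z1 z1dl z1P] := bnd b1.
pose y := Order.max z z1.
have ydl : y < dl by rewrite gt_max zdl.
have [a2 [b2 [K2 [[Aa2 Bb2 dla2 dlb2] aga2 agb2 [LK2 K20] [cK2 cL2]]]]] :=
  gP _ cl y true a1 b1 ydl Aa1 Bb1 dla1 dlb1.
have agz : agree_below z a2 a.
  move=> x xz; rewrite -aga1//; apply: aga2.
  by apply: lt_le_trans xz _; rewrite le_max lexx.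
have old m : (m <= N)%N -> exceeds a2 (b m) (L dl (b m)) = exceeds a (b m) (L dl (b m)).
  move=> mN; apply/eq_in_map => x /(allP (zP m mN)) xz.
  by rewrite agz.
exists a2, (fun m => if (m <= N)%N then b m else b2), c; split=> //.
  by move=> m _; case: ifP => // /Bb.
move=> m; rewrite leq_eqVlt => /predU1P[->|]; last first.
  by rewrite ltnS => mN; rewrite mN old//; exact: osb.
rewrite ltnn.
have [osN lastN] := osb N (leqnn N).
have -> : exceeds a2 b2 (L dl b2) =
    (exceeds a (b N) (L dl (b N)) ++ exceeds a1 b1 K1) ++ exceeds a2 b2 K2.
  rewrite {1}LK2 /exceeds map_cat -!/(exceeds _ _ _) cL2 {1}LK1.
  by rewrite /exceeds map_cat -!/(exceeds _ _ _) cL1.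
have K1n : exceeds a1 b1 K1 != [::] by case: (K1) K10.
have K2n : exceeds a2 b2 K2 != [::] by case: (K2) K20.
rewrite !rises_cat !last_cat lastN osN.
have [-> ->] := rises_const true cK1 K1n.
have [-> ->] := rises_const false cK2 K2n.
by rewrite addn0 addn1 addnS.
Qed.

(** Take [a] and the [b m] above a closure point [dl] as in
    [oscillation_at_closed], and reflect [a] to [a'] below [dl], close enough to
    [dl] for [lower a' (b m)] to be [lower dl (b m)] followed by [lower a' dl].
    On the second piece all [weight (b m)] coincide with [weight dl], so it
    contributes the same number of switches for every [m]. *)
Lemma oscillation A B (N : nat) : unbounded A -> unbounded B ->
  exists a (b : nat -> W) (c : nat), A a /\ forall m, (m <= N)%N ->
    [/\ B (b m), a < b m & osc a (b m) = (c + m)%N].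
Proof.
move=> uA uB.
have [code codeP] := restriction_code.
have [g0 g0P] := reflection W1 id (fun eta a => A a /\ eta <= a) code.
have [g1 g1P] := oscillation_at_closed uA uB.
have [dl cl] := closure_point W1 (fun z => Order.max (g0 z) (g1 z)).
have cl0 : closed_under g0 dl.
  by apply: closed_under_le cl => y; rewrite le_max lexx.
have cl1 : closed_under g1 dl.
  by apply: closed_under_le cl => y; rewrite le_max lexx orbT.
have [[z0 z0dl] _] := cl.
have [a [b [c [Aa dla Bb osb]]]] := g1P _ cl1 N.
have bnd (b' : W) : dl <= b' -> exists2 z, z < dl &
    all (< z) (L dl b') /\ forall x, z <= x -> x < dl -> wt b' x = wt dl x.
  move=> dlb.
  have [z zdl zP] := closed_finite_bound cl (finite_seq (L dl b')).
  have [y ydl yP] := closed_finite_bound cl (weight_coherent W1 eP dlb).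
  exists (Order.max z y); first by rewrite gt_max zdl.
  split.
    apply/allP => x xL; rewrite /= lt_max zP//.
    exact: (allP (lower_lt W1 w0P eP b' z0dl)).
  move=> x; rewrite ge_max => /andP[_ yx] xdl; apply: contrapT => ne.
  by have := yP x (conj xdl ne) xdl; rewrite ltNge yx.
have [z zdl zP] : exists2 z, z < dl & forall m, (m <= N)%N ->
    all (< z) (L dl (b m)) /\ forall x, z <= x -> x < dl -> wt (b m) x = wt dl x.
  have : forall m, (m <= N)%N -> dl <= b m by move=> m /Bb[].
  elim: (N) => [|M IH] dlb.
    have [z zdl zP] := bnd (b 0%N) (dlb _ (leqnn 0)); exists z => // m.
    by rewrite leqn0 => /eqP->.
  have [|z zdl zP] := IH; first by move=> m mM; apply/dlb/leqW.
  have [z' z'dl [z'P1 z'P2]] := bnd (b M.+1) (dlb _ (leqnn _)).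
  exists (Order.max z z'); first by rewrite gt_max zdl.
  move=> m; rewrite leq_eqVlt => /predU1P[->|mM].
    split; first by apply: sub_all z'P1 => x /= xz; rewrite lt_max xz orbT.
    by move=> x; rewrite ge_max => /andP[_]; exact: z'P2.
  have [zP1 zP2] := zP m mM; split.
    by apply: sub_all zP1 => x /= xz; rewrite lt_max xz.
  by move=> x; rewrite ge_max => /andP[+ _]; exact: zP2.
pose eta := walk_step e dl z.
have eta_dl : eta < dl by exact: (walk_step_lt eP zdl).
have z_eta : z <= eta by exact: (walk_step_ge eP zdl).
have rec : record e dl eta by exact: walk_step_record.
have [_ [a' [[Aa' eta_a'] ca' ea' a'dl]]] :=
  g0P _ cl0 eta a eta_dl (conj Aa (le_trans (ltW eta_dl) dla)) dla.
have ag : agree_below eta a' a.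
  by apply/codeP => //; exact: le_trans (ltW eta_dl) dla.
have low := record_low w0 eP rec ea' a'dl.
exists a', b, (c + rises true [seq (wt dl x < wt a' x)%N | x <- L a' dl])%N.
split=> // m mN.
have [BN dlN] := Bb m mN; have [zP1 zP2] := zP m mN.
split=> //; first exact: lt_le_trans dlN.
have Llt : all (< eta) (L dl (b m)).
  by apply: sub_all zP1 => x xz; exact: lt_le_trans z_eta.
have [os la] := osb m mN.
have Le : L a' (b m) = L dl (b m) ++ L a' dl.
  have [L0|Ln] := eqVneq (L dl (b m)) [::].
    by move: la; rewrite L0.
  apply: (lower_cat w0P eP a'dl dlN _ ea' Llt low).
  case: (L dl (b m)) Ln Llt => // x s _ /andP[xe _].
  exact: le_lt_trans (w0P x) xe.
have c1 : exceeds a' (b m) (L dl (b m)) = exceeds a (b m) (L dl (b m)).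
  by apply/eq_in_map => x /(allP Llt) xe; rewrite ag.
have c2 : exceeds a' (b m) (L a' dl) = [seq (wt dl x < wt a' x)%N | x <- L a' dl].
  apply/eq_in_map => x xL.
  have ex := allP (lower_ge W1 eP low a'dl) _ xL.
  have xa : x < a' := allP (lower_lt W1 w0P eP dl ea') _ xL.
  by rewrite zP2//; [exact: le_trans ex|exact: lt_trans a'dl].
rewrite /osc Le /exceeds map_cat -!/(exceeds _ _ _) rises_cat c1 c2 os la.
by rewrite addnAC.
Qed.

Definition colour a b : W := e b (logn 2 (osc a b).+1).

(** Thin out [B] so that [xi] has the same index [i] in every [e b]; it remains
    to find a pair for which [osc a b + 1] has 2-adic valuation [i]. *)
Lemma colour_surjective A B xi : unbounded A -> unbounded B ->
  exists a b, [/\ A a, B b, a < b & colour a b = xi].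
Proof.
move=> uA uB.
have [||i uBi] := unbounded_piece W1
    (B := B `&` [set b | xi < b]) (F := fun i => [set b | e b i = xi]).
- move=> g; have [b Bb] := uB (Order.max g xi).
  by rewrite gt_max => /andP[gb xib]; exists b.
- by move=> b [_ /eP[[i ei] _]]; exists i.
have [a [b [c [Aa bP]]]] := oscillation (2 ^ i.+2) uA uBi.
have [m mN mi] := logn2_interval i c.
have [[[Bb _] /= eb] ab os] := bP m mN.
by exists a, (b m); split=> //; rewrite /colour os mi.
Qed.

End Oscillation.

(** * The colouring of unordered pairs *)

Lemma upair_inj (d : Order.disp_t) (W : orderType d) (a b a' b' : W)
    (ab : a < b) (ab' : a' < b') :
  upair ab = upair ab' -> a = a' /\ b = b'.
Proof.
move=> /(congr1 sval) /= eqs.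
have : [set a'; b'] a by rewrite -eqs; left.
have : [set a'; b'] b by rewrite -eqs; right.
have : [set a; b] a' by rewrite eqs; left.
have : [set a; b] b' by rewrite eqs; right.
move=> /= h1 h2 h3 h4; move: ab ab' {eqs}.
case: h4 => ->; case: h3 => ->; rewrite ?ltxx // => lt1 lt2.
by have := lt_trans lt1 lt2; rewrite ltxx.
Qed.

Theorem theorem1p10 (d : Order.disp_t) (W : orderType d) (W1 : is_omega1 W) :
  (exists f : pairs W -> W,
     forall A B : set W, uncountable A -> uncountable B ->
     forall xi : W,
     exists (a b : W) (ab : a < b), [/\ A a, B b & f (upair ab) = xi]) /\
  ~ polarized_arrow W.
Proof.
have [u _] := countable_bounded W1 (countable0 W).
have [w0 _ w0min] := omega1_least W1 (ex_intro setT u I).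
have {}w0min x : w0 <= x by exact: w0min.
have [e eP] := enumeration_exists W1.
pose f (p : pairs W) : W := xget w0 [set w | exists (a b : W) (ab : a < b),
  p = upair ab /\ w = colour W1 w0 e a b].
have fE a b (ab : a < b) : f (upair ab) = colour W1 w0 e a b.
  apply: xget_unique; first by exists a, b, ab.
  by move=> y [a' [b' [ab' [/upair_inj[-> ->] ->]]]].
have fP A B : uncountable A -> uncountable B -> forall xi : W,
    exists (a b : W) (ab : a < b), [/\ A a, B b & f (upair ab) = xi].
  move=> /(uncountable_unbounded W1) uA /(uncountable_unbounded W1) uB xi.
  have [a [b [Aa Bb ab <-]]] := colour_surjective W1 w0min eP xi uA uB.
  by exists a, b, ab; rewrite fE.
split; first by exists f.
have [v /(_ u erefl) uv] := countable_bounded W1 (countable1 u).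
move=> /(_ (fun p => f p == u))[A [B [uA uB [i iP]]]].
have [a [b [ab [Aa Bb fu]]]] := fP A B uA uB u.
have [a' [b' [ab' [Aa' Bb' fv]]]] := fP A B uA uB v.
have := iP a' b' ab' Aa' Bb'; rewrite -(iP a b ab Aa Bb) fu fv eqxx.
by rewrite gt_eqF.
Qed.
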